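(* Let $\alpha>0$, let $N\geq 1$ be an integer, and let $\mathcal{D}=(\mathrm{D}+\alpha\,\mathrm{Id})^N$ be the exponential operator of order $N$ acting on $1$-periodic generalized functions. Then the Green's function $\psi_{\mathcal{D}}$ of $\mathcal{D}$ is given by $$\forall r\in\mathbb{R},\qquad \psi_{\mathcal{D}}(r)=P_{N-1}(r-\lfloor r\rfloor)\,e^{-\alpha(r-\lfloor r\rfloor)},$$ where $P_{N-1}(X)=a_{N-1}X^{N-1}+\dots+a_1X+a_0$ is a polynomial of degree $N-1$ whose coefficients are computed recursively as follows: $a_k=\frac{1}{k!}b_k$ for all $k\in\{0,1,\dots,N-1\}$, with $$b_{N-1}=\frac{1}{1-e^{-\alpha}},$$ $$\forall k\in\{2,3,\dots,N\},\qquad b_{N-k}=A\left[\sum_{i=1}^{k-1}\frac{1}{(k-i)!}\,b_{N-i}\right]=A\left[\sum_{i=1}^{k-1}\frac{1}{i!}\,b_{N-k+i}\right],\qquad A=\frac{e^{-\alpha}}{1-e^{-\alpha}}.$$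
   Context: The period is $1$, $\mathbb{T}=[0,1]$ with endpoints identified. $\mathcal{S}(\mathbb{T})$ is the space of infinitely differentiable $1$-periodic functions and $\mathcal{S}'(\mathbb{T})$ its topological dual (periodic generalized functions). $\mathrm{D}$ is the derivative in the sense of periodic distributions and $\mathrm{Id}$ the identity. $\text{Ш}=\sum_{i\in\mathbb{Z}}\delta(\cdot-i)$ denotes the $1$-periodic Dirac comb, i.e. $\langle \text{Ш},u\rangle=u(0)$ for $u\in\mathcal{S}(\mathbb{T})$. The operator $\mathcal{D}=(\mathrm{D}+\alpha\,\mathrm{Id})^N$ is invertible on $\mathcal{S}'(\mathbb{T})$, and its Green's function is the unique $\psi_{\mathcal{D}}\in\mathcal{S}'(\mathbb{T})$ with $\mathcal{D}\psi_{\mathcal{D}}=\text{Ш}$, that is $\psi_{\mathcal{D}}=\mathcal{D}^{-1}\{\text{Ш}\}$. The identity for $\psi_{\mathcal{D}}$ is an equality in $\mathcal{S}'(\mathbb{T})$, where a function of $r-\lfloor r\rfloor$ is identified with the periodic generalized function it defines. *)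

(* Defs.v *)
From HB Require Import structures.
From mathcomp Require Import all_boot all_order all_algebra.
From mathcomp Require Import all_classical all_reals all_analysis.

Set Implicit Arguments.
Unset Strict Implicit.
Unset Printing Implicit Defensive.

Import Order.TTheory GRing.Theory Num.Theory.
Import numFieldNormedType.Exports.

Local Open Scope classical_set_scope.
Local Open Scope ring_scope.

Section TestFunctions.
Variable R : realType.
Implicit Types (f g : R -> R^o) (a x : R).

Definition smooth f : Prop := forall k x, derivable (derive1n k f) x 1.

Definition periodic1 f : Prop := forall x, f (x + 1) = f x.

Definition ptest : {pred R -> R^o} := fun f => `[< smooth f /\ periodic1 f >].

Lemma derive1n_linear a f g k : smooth f -> smooth g ->
  derive1n k (a \*: f + g) = a \*: derive1n k f + derive1n k g.
Proof.
move=> sf sg; elim: k => [|k IH]; first by [].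
rewrite !derive1nS IH; apply/funext => x.
rewrite derive1E (deriveD (derivableZ (sf k x)) (sg k x)) (deriveZ _ (sf k x)).
by rewrite -!derive1E.
Qed.

Lemma smooth_linear a f g : smooth f -> smooth g -> smooth (a \*: f + g).
Proof.
move=> sf sg k x; rewrite derive1n_linear; [|exact: sf|exact: sg].
exact: (derivableD (derivableZ (sf k x)) (sg k x)).
Qed.

Lemma smooth_derive1 f : smooth f -> smooth (derive1 f).
Proof. by move=> sf k x; rewrite -derive1Sn; exact: (sf k.+1 x). Qed.

Lemma periodic1_derive1 f : periodic1 f -> periodic1 (derive1 f).
Proof.
move=> pf x; rewrite /derive1.
suff -> : (fun h => h^-1 *: (f (h + (x + 1)) - f (x + 1))) =
          (fun h => h^-1 *: (f (h + x) - f x)) by [].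
by apply/funext => h; rewrite addrA !pf.
Qed.

Lemma ptest_submod_closed : submod_closed ptest.
Proof.
have s0 : smooth (0 : R -> R^o).
  move=> k; have -> : derive1n k (0 : R -> R^o) = cst (0 : R^o).
    elim: k => [//|k IH]; rewrite derive1nS IH.
    by apply/funext => x; exact: derive1_cst.
  by move=> x; exact: (derivable_cst (0 : R^o) x 1).
split; first by apply/asboolP; split.
move=> a f g /asboolP[sf pf] /asboolP[sg pg]; apply/asboolP.
split; first exact: (smooth_linear sf sg).
by move=> x; rewrite !fctE pf pg.
Qed.

HB.instance Definition _ :=
  GRing.isSubmodClosed.Build R (R -> R^o) ptest ptest_submod_closed.

(* [test] is S(T), and [distr] below is its topological dual S'(T). *)
Record test := Test { test_fun :> R -> R^o ; _ : test_fun \in ptest }.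

HB.instance Definition _ := [isSub for test_fun].
HB.instance Definition _ := [Choice of test by <:].
HB.instance Definition _ := [SubChoice_isSubLmodule of test by <:].

(* The Fréchet topology of S(T): the coarsest topology for which each map
   [u |-> derive1n k u] is continuous for uniform convergence. *)
Definition jets (u : test) : {ptws nat -> {uniform R -> R^o}} :=
  fun k => derive1n k u.

HB.instance Definition _ := Uniform.copy test (initial_topology jets).

Lemma test_smooth (u : test) : smooth u.
Proof. by have /asboolP[] := valP u. Qed.

Lemma test_periodic1 (u : test) : periodic1 u.
Proof. by have /asboolP[] := valP u. Qed.

Lemma test_derive_subproof (u : test) : derive1 u \in ptest.
Proof.
apply/asboolP; split; first exact/smooth_derive1/test_smooth.
exact/periodic1_derive1/test_periodic1.
Qed.

Definition test_derive (u : test) : test := Test (test_derive_subproof u).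

Lemma test_derive_linear a (u v : test) :
  test_derive (a *: u + v) = a *: test_derive u + test_derive v.
Proof.
apply/val_inj.
exact: (@derive1n_linear a u v 1 (@test_smooth u) (@test_smooth v)).
Qed.

Lemma jet_continuous k :
  continuous (fun u : test => jets u k : {uniform R -> R^o}).
Proof.
move=> u; apply: (@continuous_comp test {ptws nat -> {uniform R -> R^o}}
  {uniform R -> R^o} jets (fun j => j k) u).
  exact: initial_continuous.
exact: (@proj_continuous nat (fun=> {uniform R -> R^o}) k (jets u)).
Qed.

Lemma test_derive_continuous : continuous test_derive.
Proof.
suff : continuous (jets \o test_derive) by exact: continuous_comp_initial.
move=> u; apply/cvg_sup; first exact/fmap_filter/nbhs_filter.
move=> k; move: u.
apply: (@continuous_comp_initial _ test _
  (fun j : {ptws nat -> {uniform R -> R^o}} => j k)).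
suff -> : (fun j : {ptws nat -> {uniform R -> R^o}} => j k)
    \o (jets \o test_derive) = fun u => jets u k.+1 by exact: jet_continuous.
by apply/funext => u; rewrite /jets /= -derive1Sn.
Qed.

End TestFunctions.

Section Distributions.
Variable R : realType.
Local Notation test := (test R).

Definition pdist : {pred test -> R^o} :=
  fun T => `[< linear T /\ continuous T >].

Lemma pdist_submod_closed : submod_closed pdist.
Proof.
split.
  apply/asboolP; split; last by move=> x; exact: cst_continuous.
  by move=> a u v; rewrite -[RHS]/(a *: (0 : R^o) + 0) scaler0 addr0.
move=> a S T /asboolP[lS cS] /asboolP[lT cT]; apply/asboolP; split.
  move=> c u v; rewrite -[LHS]/(a *: S (c *: u + v) + T (c *: u + v)) lS lT.
  rewrite -[RHS]/(c *: (a *: S u + T u) + (a *: S v + T v)).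
  by rewrite !scalerDr !scalerA (mulrC a c) addrACA.
move=> u; have cZ : (a \*: S) v @[v --> u] --> a *: S u.
  apply: (@continuous_comp test R^o R^o S (fun y => a *: y) u (cS u)).
  exact: scaler_continuous.
exact: (cvgD cZ (cT u)).
Qed.

HB.instance Definition _ :=
  GRing.isSubmodClosed.Build R (test -> R^o) pdist pdist_submod_closed.

Record distr := Distr { distr_fun :> test -> R^o ; _ : distr_fun \in pdist }.

HB.instance Definition _ := [isSub for distr_fun].
HB.instance Definition _ := [Choice of distr by <:].
HB.instance Definition _ := [SubChoice_isSubLmodule of distr by <:].

Lemma distr_linear (T : distr) : linear T.
Proof. by have /asboolP[] := valP T. Qed.

Lemma distr_continuous (T : distr) : continuous T.
Proof. by have /asboolP[] := valP T. Qed.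

Lemma distr_derive_subproof (T : distr) :
  (fun u : test => - T (test_derive u) : R^o) \in pdist.
Proof.
apply/asboolP; split.
  move=> a u v; rewrite test_derive_linear (@distr_linear T) opprD.
  by rewrite scalerN.
move=> u; have cT : T (test_derive v) @[v --> u] --> T (test_derive u).
  apply: (@continuous_comp test test R^o (@test_derive R) T u).
    exact: test_derive_continuous.
  exact: distr_continuous.
exact: (cvgN cT).
Qed.

(* <D T, u> = - <T, u'> : no boundary term by periodicity. *)
Definition distr_derive (T : distr) : distr := Distr (distr_derive_subproof T).

Lemma dirac_comb_subproof : (fun u : test => u 0 : R^o) \in pdist.
Proof.
apply/asboolP; split; first by move=> a u v.
move=> u; pose e0 (g : {uniform R -> R^o}) : R^o := g 0.
apply: (@continuous_comp test {uniform R -> R^o} R^o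
  (fun u => jets u 0%N) e0 u); first exact: jet_continuous.
have : {ptws, nbhs (jets u 0%N : {uniform R -> R^o}) --> jets u 0%N}.
  by apply: pointwise_uniform_cvg; exact: cvg_id.
move=> /(cvg_app e0)/cvg_trans; apply.
exact: (@proj_continuous R (fun=> R^o) 0 (jets u 0%N)).
Qed.

(* Over one period, sum_i delta(. - i) acts as evaluation at 0. *)
Definition dirac_comb : distr := Distr dirac_comb_subproof.

Definition exp_op (alpha : R) (N : nat) (T : distr) : distr :=
  iter N (fun S => distr_derive S + alpha *: S) T.

(* [psi] is the unique solution of [L psi = dirac_comb]: its existence and
   uniqueness replace the notation L^-1{dirac_comb}. *)
Definition is_green (L : distr -> distr) (psi : distr) : Prop :=
  forall phi, L phi = dirac_comb <-> phi = psi.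

Definition is_function (psi : distr) (f : R -> R) : Prop :=
  [/\ periodic1 f,
      lebesgue_measure.-integrable `[0%R, 1%R] (EFin \o f) &
      forall u : test,
        psi u = \int[lebesgue_measure]_(x in `[0%R, 1%R]) (f x * u x)].

End Distributions.

(* Main.v *)
Require Import Defs.
From HB Require Import structures.
From mathcomp Require Import all_boot all_order all_algebra.
From mathcomp Require Import all_classical all_reals all_analysis.
From mathcomp Require Import ring lra zify.
Import Order.TTheory GRing.Theory Num.Theory.
Import numFieldNormedType.Exports.
Local Open Scope classical_set_scope.
Local Open Scope ring_scope.

(** For a polynomial Q, let T_Q be the periodic distribution given by the
    function Q(x) e^(- alpha x) on [0, 1). Inside the period, D + alpha acts on
    it as Q |-> Q'; at the seam it produces the jump of the function, so that
      (D + alpha) T_Q = T_(Q') + (Q(0) - Q(1) e^(- alpha)) delta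
    ([exp_op1_exp_poly], an integration by parts). Hence, if the functions
    Q^(j)(x) e^(- alpha x) have jump 0 at the seam for j < n and jump 1 for
    j = n, and Q has degree at most n, then (D + alpha)^(n+1) T_Q is the Dirac
    comb ([green_exp_poly]). As b_j is the value of the j-th derivative of P
    at 0 and the sum of the b_(j+i) / i! its value at 1, the recursion for b
    says exactly that the jumps for j < N - 1 are 0 ([exp_recursion_seam]),
    and the value of b_(N-1) that the last one is 1.

    For uniqueness it suffices that D + alpha is injective, that is, by
    duality, that every test function v has the form alpha u - u' for a
    periodic smooth u. Up to the factor 1 - e^(- alpha), which is not 0, such
    a u is the weighted average
      x |-> integral over t in [0, 1] of e^(- alpha t) v(x + t)
    ([test_averageE]). This formula is visibly periodic, its derivatives are
    the averages of the derivatives of v, and integration by parts gives the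
    equation. *)

(** * Continuous functions as periodic distributions *)

Section Pairing.
Variable R : realType.
Local Notation mu := (@lebesgue_measure R).
Implicit Types (f g F G : R -> R) (u v : test R).

Lemma is_derive_continuous F f :
  (forall x : R, is_derive x 1 F (f x)) -> continuous F.
Proof.
by move=> dF x; apply/differentiable_continuous/derivable1_diffP; case: (dF x).
Qed.

Lemma smooth_is_derive (f : R -> R^o) (x : R) :
  smooth f -> is_derive x 1 f (derive1 f x).
Proof. by move=> sf; rewrite derive1E; apply/derivableP/(sf 0%N). Qed.

Lemma smooth_continuous (f : R -> R^o) : smooth f -> continuous f.
Proof.
by move=> sf; apply: is_derive_continuous => x; exact: smooth_is_derive.
Qed.

Lemma test_continuous u : continuous u.
Proof. exact/smooth_continuous/test_smooth. Qed.

Lemma continuous_integrable01 f :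
  continuous f -> mu.-integrable `[0%R, 1%R] (EFin \o f).
Proof.
move=> cf; apply: continuous_compact_integrable; first exact: segment_compact.
exact: continuous_subspaceT.
Qed.

Lemma Rintegration_by_parts01 F G f g :
  (forall x : R, is_derive x 1 F (f x)) -> (forall x : R, is_derive x 1 G (g x)) ->
  continuous f -> continuous g ->
  \int[mu]_(x in `[0, 1]) (F x * g x) =
  F 1 * G 1 - F 0 * G 0 - \int[mu]_(x in `[0, 1]) (f x * G x).
Proof.
have LR (H h : R -> R) : (forall x : R, is_derive x 1 H (h x)) ->
    derivable_oo_LRcontinuous H 0 1 /\ {in `]0%R, 1%R[, derive1 H =1 h}.
  move=> dH; have cH := is_derive_continuous _ _ dH; split; last first.
    by move=> x _; rewrite derive1E; case: (dH x).
  by split=> [x _||]; [case: (dH x) | exact/cvg_at_right_filter/cH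
    | exact/cvg_at_left_filter/cH].
move=> /LR[LF dF] /LR[LG dG] cf cg.
by apply: Rintegration_by_parts => //; exact: continuous_subspaceT.
Qed.

Definition pairing01 g u : R^o := \int[mu]_(x in `[0, 1]) (g x * u x).

Lemma continuous_bounded_itv f a b : continuous f ->
  exists M, forall x, a <= x <= b -> `|f x| <= M.
Proof.
move=> cf; have [M [_ bM]] : bounded_set (f @` `[a, b]).
  apply: compact_bounded; apply: continuous_compact; last exact: segment_compact.
  exact: continuous_subspaceT.
exists (M + 1) => x axb; apply: (bM (M + 1)); first by rewrite ltrDl.
by exists x => //=; rewrite in_itv.
Qed.

(** Continuity for the topology of S(T) only uses the jet of order 0: the
    pairing is bounded by a multiple of the uniform norm. *)
Lemma pairing01_pdist g : continuous g -> pairing01 g \in @pdist R.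
Proof.
move=> cg.
have ig u : mu.-integrable `[0%R, 1%R] (EFin \o (fun x => g x * u x)).
  apply: continuous_integrable01 => x.
  by apply: cvgM; [exact: cg|exact: test_continuous].
have lin : linear (pairing01 g).
  move=> a u v; rewrite /pairing01.
  transitivity (\int[mu]_(x in `[0, 1]) (a * (g x * u x) + g x * v x)).
    apply: eq_Rintegral => x _.
    by rewrite -[(a *: u + v) x]/(a * u x + v x) mulrDr mulrCA.
  have iag : mu.-integrable `[0%R, 1%R] (EFin \o (fun x => a * (g x * u x))).
    apply: continuous_integrable01 => x.
    apply: cvgM; first exact: cvg_cst.
    by apply: cvgM; [exact: cg|exact: test_continuous].
  by rewrite RintegralD// RintegralZl.
apply/asboolP; split => // u.
have [M gM] := continuous_bounded_itv g 0 1 cg.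
have M0 : 0 <= M by apply: le_trans (normr_ge0 (g 0)) (gM 0 _); rewrite lexx ler01.
apply/(@cvgrPdist_le R R^o (test R) (nbhs u) (nbhs_filter u)) => e e0.
(* Dividing by M + 1 rather than by M covers a g that vanishes on [0, 1]. *)
pose d := e / (M + 1).
have d0 : 0 < d by rewrite divr_gt0// ltr_wpDl.
have near_u : nbhs u [set v : test R | forall x, `|u x - v x| < d].
  apply: (@jet_continuous R 0%N u [set h | forall x, `|u x - h x| < d]).
  apply/uniform_nbhs.
  exists [set xy : R^o * R^o | ball xy.1 d xy.2]; split.
    exact: (entourage_ball _ (PosNum d0)).
  by move=> h /= uh x; exact: uh.
apply: (@filterS _ _ (nbhs_filter u) _ _ _ near_u) => v /= uv.
have -> : pairing01 g u - pairing01 g v = pairing01 g (u - v).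
  by rewrite (GRing.zmod_morphism_linear lin).
apply: le_trans (le_normr_Rintegral _ (ig _)) _; first by [].
have cstM : mu.-integrable `[0%R, 1%R] (EFin \o cst (M * d)).
  by apply: continuous_integrable01 => ?; exact: cvg_cst.
apply: (@le_trans _ _ (\int[mu]_(x in `[0, 1]) (M * d))).
  apply: le_Rintegral => //; first exact: (integrable_abse (ig (u - v))).
  move=> x /= ; rewrite in_itv /= => x01; rewrite normrM ler_pM//; first exact: gM.
  exact/ltW/uv.
rewrite Rintegral_cst//= lebesgue_measure_itv/= lte01 sube0 /= mulr1.
rewrite /d mulrCA ger_pMr// ler_pdivrMr ?ltr_wpDl// mul1r.
by rewrite lerDl.
Qed.

End Pairing.

(** * Exponential polynomials and the operator D + alpha *)

Section ExpPoly.
Variable R : realType.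
Local Notation mu := (@lebesgue_measure R).
Implicit Types (f g : R -> R) (Q : {poly R}) (u v : test R).
Variable alpha : R.

Definition exp_poly Q (x : R) : R := Q.[x] * expR (- alpha * x).

Lemma is_derive_exp_decay (x : R) :
  is_derive x 1 (fun y => expR (- alpha * y)) (- alpha * expR (- alpha * x)).
Proof.
have lin : is_derive x 1 (fun y : R => - alpha * y) (- alpha).
  have := @is_deriveZ _ _ _ id (- alpha) x 1 _ (is_derive_id x (1 : R)).
  by rewrite /GRing.scale /= mulr1.
rewrite mulrC.
exact: (@is_derive1_comp _ expR (fun y : R => - alpha * y)).
Qed.

Lemma continuous_exp_decay : continuous (fun x : R => expR (- alpha * x)).
Proof. exact: is_derive_continuous is_derive_exp_decay. Qed.

Lemma is_derive_exp_poly Q (x : R) :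
  is_derive x 1 (exp_poly Q) (exp_poly Q^`() x - alpha * exp_poly Q x).
Proof.
have := @is_deriveM _ _ (horner Q) (fun y => expR (- alpha * y)) x 1 _ _
  (is_derive_poly Q x) (is_derive_exp_decay x).
move=> dQe; apply: is_derive_eq; rewrite /GRing.scale /= /exp_poly; ring.
Qed.

Lemma continuous_exp_poly Q : continuous (exp_poly Q).
Proof. by apply: is_derive_continuous => x; exact: is_derive_exp_poly. Qed.

Definition exp_poly_distr Q : distr R :=
  Distr (pairing01_pdist R (exp_poly Q) (continuous_exp_poly Q)).

(** Integrating - <T_Q, u'> by parts, the boundary terms do not cancel: as
    u 1 = u 0, they leave the jump of the function at the seam, times u 0. *)
Lemma exp_op1_exp_poly Q :
  distr_derive (exp_poly_distr Q) + alpha *: exp_poly_distr Q =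
  exp_poly_distr Q^`() +
    (Q.[0] - Q.[1] * expR (- alpha)) *: dirac_comb R.
Proof.
apply/val_inj/funext => u.
rewrite -[LHS]/(- pairing01 _ (exp_poly Q) (test_derive u) +
  alpha * pairing01 _ (exp_poly Q) u).
rewrite -[RHS]/(pairing01 _ (exp_poly Q^`()) u +
  (Q.[0] - Q.[1] * expR (- alpha)) * u 0).
have du (x : R) : is_derive x 1 u (test_derive u x).
  exact/smooth_is_derive/test_smooth.
have cuv g v : continuous g -> continuous (fun x => g x * v x : R).
  by move=> cg x; apply: cvgM; [exact: cg|exact: test_continuous].
have iuv g v : continuous g ->
    mu.-integrable `[0%R, 1%R] (EFin \o (fun x => g x * v x)).
  by move=> cg; apply/continuous_integrable01/cuv.
rewrite {1}/pairing01 (Rintegration_by_parts01 _ _ _ _ _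
  (is_derive_exp_poly Q) du); last 2 first.
- move=> x; apply: cvgB; first exact: continuous_exp_poly.
  by apply: cvgM; [exact: cvg_cst|exact: continuous_exp_poly].
- exact: test_continuous.
have -> : \int[mu]_(x in `[0, 1])
      ((exp_poly Q^`() x - alpha * exp_poly Q x) * u x) =
    pairing01 _ (exp_poly Q^`()) u - alpha * pairing01 _ (exp_poly Q) u.
  rewrite /pairing01 -RintegralZl//; last exact/iuv/continuous_exp_poly.
  rewrite -RintegralB//; last 2 first.
  - exact/iuv/continuous_exp_poly.
  - apply: continuous_integrable01 => x.
    by apply: cvgM; [exact: cvg_cst|exact/cuv/continuous_exp_poly].
  by apply: eq_Rintegral => x _; rewrite mulrBl mulrA.
have -> : u 1 = u 0 by rewrite -(@test_periodic1 R u 0) add0r.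
by rewrite /exp_poly mulr0 expR0 !mulr1; ring.
Qed.

Lemma exp_op_exp_poly Q n :
  (forall j, (j < n)%N -> Q^`(j).[0] = Q^`(j).[1] * expR (- alpha)) ->
  exp_op alpha n (exp_poly_distr Q) = exp_poly_distr Q^`(n).
Proof.
elim: n => [|n IH] seam; first by rewrite derivn0.
rewrite /exp_op iterS -[iter n _ _]/(exp_op alpha n _) IH; last first.
  by move=> j jn; apply: seam; rewrite ltnW.
by rewrite exp_op1_exp_poly seam// subrr scale0r addr0 derivnS.
Qed.

(** The first n steps differentiate the polynomial without leaving the space of
    functions; the last one kills it, by the bound on its degree, and leaves
    its unit jump. *)
Lemma green_exp_poly Q n :
  (forall j, (j < n)%N -> Q^`(j).[0] = Q^`(j).[1] * expR (- alpha)) ->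
  Q^`(n).[0] - Q^`(n).[1] * expR (- alpha) = 1 ->
  (size Q <= n.+1)%N ->
  exp_op alpha n.+1 (exp_poly_distr Q) = dirac_comb R.
Proof.
move=> seam jump sQ.
rewrite /exp_op iterS -[iter n _ _]/(exp_op alpha n _) exp_op_exp_poly//.
rewrite exp_op1_exp_poly jump scale1r -derivnS derivn_poly0//.
apply/val_inj/funext => u.
rewrite -[LHS]/(pairing01 _ (exp_poly 0) u + u 0) /pairing01.
under eq_Rintegral do rewrite /exp_poly horner0 !mul0r.
by rewrite Rintegral_cst// mul0r add0r.
Qed.

(** * Injectivity of the operator *)

(** For periodic f, a multiple of the convolution of f with the Green's function
    of the transpose - D + alpha of D + alpha. *)
Definition exp_average f (x : R) : R :=
  \int[mu]_(t in `[0, 1]) (expR (- alpha * t) * f (x + t)).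

(** Differentiation under the integral sign; on the neighbourhood of x of
    radius 1, the domination is by the product of bounds on the weight and on
    the derivative of f over [x - 1, x + 2]. *)
Lemma is_derive_exp_average (f : R -> R^o) (x : R) : smooth f ->
  is_derive x 1 (exp_average f) (exp_average (derive1 f) x).
Proof.
move=> sf.
have cf := smooth_continuous _ _ (smooth_derive1 sf).
have [M fM] := continuous_bounded_itv _ _ (x - 1) (x + 2) cf.
have [M' eM] : exists M' : R, forall t : R, 0 <= t <= 1 -> `|expR (- alpha * t)| <= M'.
  exact: (continuous_bounded_itv _ (fun t => expR (- alpha * t)) _ _
    continuous_exp_decay).
pose h y t := expR (- alpha * t) * f (y + t).
have dh (y t : R) : is_derive y 1 (h ^~ t) (expR (- alpha * t) * derive1 f (y + t)).
  have df : is_derive (y + t) 1 f (derive1 f (y + t)) by exact: smooth_is_derive.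
  have := @is_derive1_comp _ f (shift t) y _ _ df (is_derive_shift _ _ _).
  rewrite mulr1 => dft.
  exact: (@is_deriveZ _ _ _ (f \o shift t) (expR (- alpha * t)) y 1 _ dft).
have d1h y t : partial1of2 h y t = expR (- alpha * t) * derive1 f (y + t).
  by rewrite partial1of2E; case: (dh y t).
have ih y : mu.-integrable `[0%R, 1%R] (EFin \o h y).
  apply: continuous_integrable01 => t; apply: cvgM.
    exact: continuous_exp_decay.
  apply: (@continuous_comp R R R (fun t => y + t) f).
    by apply: cvgD; [exact: cvg_cst|exact: cvg_id].
  exact: smooth_continuous.
have Ix : `]x - 1, x + 1[%classic x by rewrite /= in_itv /= ltrBlDr ltrDl ltr01.
have M0 : 0 <= M' * M.
  apply: mulr_ge0; first by apply: le_trans (eM 0 _); rewrite // lexx ler01.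
  by apply: le_trans (fM x _); rewrite // lerBlDr !lerDl ler01 ler0n.
have iM : mu.-integrable `[0%R, 1%R] (EFin \o cst (M' * M)).
  by apply: continuous_integrable01 => ?; exact: cvg_cst.
have dhI y t : `]x - 1, x + 1[%classic y -> `[0%R, 1%R]%classic t ->
  derivable (h ^~ t) y 1 by case: (dh y t).
have ub y t : `]x - 1, x + 1[%classic y -> `[0%R, 1%R]%classic t ->
    `|partial1of2 h y t| <= cst (M' * M) t.
  rewrite /= !in_itv /= => yx t01; rewrite d1h normrM ler_pM//; first exact: eM.
  by apply: fM; lra.
have mI : measurable (`[0%R, 1%R] : set (measurableTypeR R)) by [].
apply: DeriveDef.
  exact: (derivable_under_integral mI Ix (fun y _ => ih y) dhI (fun=> M0) iM ub).
rewrite -derive1E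
  (differentiation_under_integral mI Ix (fun y _ => ih y) dhI (fun=> M0) iM ub).
by apply: eq_Rintegral => t _; exact: d1h.
Qed.

Lemma derive1n_exp_average (f : R -> R^o) k : smooth f ->
  derive1n k (exp_average f) = exp_average (derive1n k f).
Proof.
elim: k f => [//|k IH] f sf.
rewrite !derive1Sn -IH; last exact: smooth_derive1.
congr derive1n; apply/funext => x; rewrite derive1E.
by case: (is_derive_exp_average f x sf).
Qed.

Lemma exp_average_ptest u : exp_average u \in @ptest R.
Proof.
apply/asboolP; split=> [k x|x].
  rewrite (derive1n_exp_average _ _ (@test_smooth R u)).
  have sk : smooth (derive1n k u : R -> R^o).
    elim: k => [|k IH]; first exact: test_smooth.
    by rewrite derive1nS; exact: smooth_derive1.
  by case: (is_derive_exp_average _ x sk).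
by apply: eq_Rintegral => t _; rewrite addrAC (@test_periodic1 R u).
Qed.

Definition test_average u : test R := Test (exp_average_ptest u).

(** Both boundary terms of the integration by parts are multiples of u x: the
    average runs over exactly one period. *)
Lemma test_averageE u :
  alpha *: test_average u - test_derive (test_average u) =
  (1 - expR (- alpha)) *: u.
Proof.
apply/val_inj/funext => x.
rewrite -[LHS]/(alpha * exp_average u x - derive1 (exp_average u) x).
rewrite -[RHS]/((1 - expR (- alpha)) * u x).
have -> : derive1 (exp_average u) x = exp_average (test_derive u) x.
  by rewrite derive1E; case: (is_derive_exp_average _ x (@test_smooth R u)).
have du (t : R) : is_derive t 1 (fun t => u (x + t)) (test_derive u (x + t)).
  have df : is_derive (t + x) 1 u (test_derive u (t + x)).
    exact/smooth_is_derive/test_smooth.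
  have := @is_derive1_comp _ u (shift x) t _ _ df (is_derive_shift _ _ _).
  rewrite mulr1 addrC; congr is_derive; apply/funext => s.
  by rewrite /= addrC.
have ce := continuous_exp_decay.
have ctr v : continuous (fun t => v (x + t)).
  move=> t; apply: (@continuous_comp R R R (fun t => x + t) v).
    by apply: cvgD; [exact: cvg_cst|exact: cvg_id].
  exact: test_continuous.
rewrite {2}/exp_average (Rintegration_by_parts01 _ _ _ _ _
  is_derive_exp_decay du); last 2 first.
- by move=> t; apply: cvgM; [exact: cvg_cst|exact: ce].
- exact: ctr.
rewrite mulr0 expR0 mulr1 addr0 (@test_periodic1 R u).
have -> : \int[mu]_(t in `[0, 1]) (- alpha * expR (- alpha * t) * u (x + t)) =
    - alpha * exp_average u x.
  rewrite /exp_average -RintegralZl//.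
    by apply: eq_Rintegral => t _; rewrite mulrA.
  by apply: continuous_integrable01 => t; apply: cvgM; [exact: ce|exact: ctr].
by ring.
Qed.

(** By [test_averageE], the value of S at u is, up to 1 - e^(- alpha), the value
    of (D + alpha) S at the average of u. *)
Lemma exp_op1_inj : expR (- alpha) != 1 ->
  injective (fun S : distr R => distr_derive S + alpha *: S).
Proof.
move=> e1 S T eqST; apply/val_inj/funext => u.
have val_on (U : distr R) : (1 - expR (- alpha)) * U u =
    (distr_derive U + alpha *: U : distr R) (test_average u).
  have lU := @distr_linear R U.
  rewrite -[RHS]/(- U (test_derive (test_average u)) +
    alpha * U (test_average u)) [RHS]addrC.
  transitivity (U (alpha *: test_average u - test_derive (test_average u))).
    by rewrite test_averageE (GRing.scalable_linear lU).
  by rewrite (GRing.zmod_morphism_linear lU) (GRing.scalable_linear lU).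
have e0 : 1 - expR (- alpha) != 0 by rewrite subr_eq0 eq_sym.
by apply: (mulfI e0); rewrite !val_on eqST.
Qed.

Lemma exp_op_inj n : expR (- alpha) != 1 -> injective (@exp_op R alpha n).
Proof.
move=> e1; elim: n => [|n IH] S T //.
by rewrite /exp_op !iterS => /(exp_op1_inj e1)/IH.
Qed.

End ExpPoly.

(** * The periodized function *)

(** On [0, 1] the periodization of g differs from g only at 1, where its value
    is g 0: a null set, invisible to integrability and to the integrals. *)
Lemma is_function_periodize (R : realType) (psi : distr R) (g : R -> R) :
  continuous g -> psi =1 pairing01 R g ->
  is_function psi (fun r => g (r - (Num.floor r)%:~R)).
Proof.
move=> cg psig; set mu := @lebesgue_measure R.
pose f r := g (r - (Num.floor r)%:~R).
have fg x : x \in (`[0%R, 1%R] `\ 1 : set R) -> g x = f x.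
  rewrite inE /= in_itv /= => -[/andP[x0 x1] /eqP x_neq1].
  rewrite /f (_ : Num.floor x = 0) ?subr0//.
  by apply: floor_def; rewrite x0 add0r lt_neqAle x_neq1.
have mD : measurable (`[0%R, 1%R] : set (measurableTypeR R)) by [].
have m1 : measurable ([set 1] : set (measurableTypeR R)) by [].
have mD1 := measurableD mD m1.
have mu1 : mu [set 1] = 0%E by exact: lebesgue_measure_set1.
have seam h k : mu.-integrable `[0%R, 1%R] (EFin \o h) ->
    {in (`[0%R, 1%R] `\ 1 : set R), h =1 k} ->
    mu.-integrable `[0%R, 1%R] (EFin \o k) /\
    \int[mu]_(x in `[0, 1]) k x = \int[mu]_(x in `[0, 1]) h x.
  move=> ih hk.
  have ihk : mu.-integrable (`[0%R, 1%R] `\ 1) (EFin \o k).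
    apply: (eq_integrable mD1 (EFin \o h)).
      by move=> x xD /=; rewrite hk.
    by apply: integrableS ih => //; exact: subDsetl.
  have ik : mu.-integrable `[0%R, 1%R] (EFin \o k).
    apply/(negligible_integrable m1 mD _ mu1) => //.
    have D1 : `[0%R, 1%R]%classic = (`[0%R, 1%R] `\ 1) `|` [set 1] :> set R.
      rewrite setUC setDUK// => x ->; rewrite /= in_itv /=.
      by rewrite ler01 lexx.
    rewrite [X in measurable_fun X _]D1; apply/measurable_funU => //; split.
      exact: (measurable_int mu).
    exact: measurable_fun_set1.
  split=> //; rewrite /Rintegral.
  rewrite (negligible_integral m1 mD ik mu1) (negligible_integral m1 mD ih mu1).
  by congr fine; apply: eq_integral => x xD /=; rewrite hk.
split.
- move=> r; rewrite floorDrz ?rpred1// floor1 rmorphD /=.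
  by congr g; ring.
- exact: (seam _ _ (continuous_integrable01 _ _ cg) fg).1.
- move=> u; rewrite psig; symmetry; apply: (seam _ _ _ _).2.
    apply: continuous_integrable01 => x.
    by apply: cvgM; [exact: cg|exact: test_continuous].
  by move=> x xD; rewrite (fg x xD).
Qed.

(** * The recursion as a condition at the seam *)

(** Differentiating an exponential generating polynomial shifts its
    coefficients. *)
Lemma derivn_poly_fact (R : realType) (b : nat -> R) n j :
  (\poly_(k < n) ((k`!%:R)^-1 * b k))^`(j) =
  \poly_(k < n - j) ((k`!%:R)^-1 * b (j + k)%N).
Proof.
apply/polyP => i; rewrite coef_derivn !coef_poly ltn_subRL.
case: ifP => _; last by rewrite mul0rn.
rewrite -[LHS]mulr_natr mulrAC; congr (_ * _).
have fN0 k : (k`!%:R : R) != 0 by rewrite pnatr_eq0 -lt0n fact_gt0.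
have := ffact_fact (leq_addr i j); rewrite addKn => /(congr1 (fun k => k%:R : R)).
rewrite natrM => jiE; apply: (mulIf (fN0 i)).
by rewrite mulVf// -mulrA jiE mulVf.
Qed.

(** With S the sum in the recursion, P^(j)(0) = b_j and P^(j)(1) = b_j + S, so
    that b_j = (b_j + S) e is the recursion solved for b_j. *)
Lemma exp_recursion_seam (R : realType) (e : R) (b : nat -> R) n j :
  e != 1 ->
  b j = e / (1 - e) * \sum_(1 <= i < n - j) (i`!%:R)^-1 * b (j + i)%N ->
  (j < n)%N ->
  let P := \poly_(k < n) ((k`!%:R)^-1 * b k) in
  P^`(j).[0] = P^`(j).[1] * e.
Proof.
move=> e1 bj jn P; rewrite derivn_poly_fact horner_coef0 coef_poly subn_gt0 jn.
rewrite fact0 invr1 mul1r addn0 horner_poly.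
under eq_bigr do rewrite expr1n mulr1.
rewrite -(big_mkord xpredT (fun k => (k`!%:R)^-1 * b (j + k)%N)).
rewrite big_ltn ?subn_gt0// fact0 invr1 mul1r addn0.
have e0 : 1 - e != 0 by rewrite subr_eq0 eq_sym.
set S := \sum_(_ <= _ < _) _ in bj *.
by rewrite bj; field.
Qed.

Theorem mainTheorem1 (R : realType) (alpha : R) (N : nat) (b : nat -> R) :
  let A := expR (- alpha) / (1 - expR (- alpha)) in
  let P : {poly R} := \poly_(k < N) ((k`!%:R)^-1 * b k) in
  0 < alpha ->
  (1 <= N)%N ->
  b (N - 1)%N = 1 / (1 - expR (- alpha)) ->
  (forall k : nat, (2 <= k <= N)%N ->
     b (N - k)%N = A * \sum_(1 <= i < k) (((k - i)`!)%:R)^-1 * b (N - i)%N) ->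
  [/\ forall k : nat, (2 <= k <= N)%N ->
        b (N - k)%N = A * \sum_(1 <= i < k) (i`!%:R)^-1 * b (N - k + i)%N,
      size P = N &
      exists psi : distr R,
        is_green (exp_op alpha N) psi /\
        is_function psi (fun r : R =>
          P.[r - (Num.floor r)%:~R] * expR (- alpha * (r - (Num.floor r)%:~R)))].
Proof.
move=> A P alpha0 N1 btop brec.
have e1 : expR (- alpha) != 1.
  by rewrite lt_eqF// -expR0 ltr_expR oppr_lt0.
have e0 : 1 - expR (- alpha) != 0 by rewrite subr_eq0 eq_sym.
have brec' k : (2 <= k <= N)%N ->
    b (N - k)%N = A * \sum_(1 <= i < k) (i`!%:R)^-1 * b (N - k + i)%N.
  move=> k2N; rewrite brec//; congr (_ * _).
  rewrite big_nat_rev big_nat [RHS]big_nat; apply: eq_bigr => i ik /=.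
  by congr (_%:R^-1 * b _); [congr (_`!)|]; lia.
split=> //.
  apply: size_poly_eq; rewrite -subn1 btop mul1r.
  by rewrite mulf_neq0// invr_eq0// pnatr_eq0 -lt0n fact_gt0.
case: N => [//|n] in N1 btop brec brec' P *.
exists (exp_poly_distr R alpha P); split; last first.
  exact: (@is_function_periodize R _ (exp_poly R alpha P)
    (continuous_exp_poly R alpha P)).
have seam j : (j < n)%N -> P^`(j).[0] = P^`(j).[1] * expR (- alpha).
  move=> jn; apply: exp_recursion_seam => //; last exact: leqW.
  have := brec' (n.+1 - j)%N; rewrite subKn; last exact/leqW/ltnW.
  by apply; lia.
have jump : P^`(n).[0] - P^`(n).[1] * expR (- alpha) = 1.
  rewrite derivn_poly_fact subSnn horner_coef0 coef_poly horner_poly big_ord1.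
  rewrite expr1n fact0 /= addn0; move: btop; rewrite subn1 /= => ->.
  by field.
have LP := green_exp_poly _ _ _ _ seam jump (size_poly _ _).
by move=> phi; split=> [|-> //]; rewrite -LP => /(exp_op_inj _ _ _ e1).
Qed.
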